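(* Let $G$ be a finite group. Then $\Lambda_c(G)$ is normal in $\mathrm{Aut}(\mathcal{D}(G))$ if and only if $G$ is a stem group. Therefore, $\mathrm{Aut}(\mathcal{D}(G))$ is the (internal) semidirect product $\Lambda_c(G)\rtimes L$ of the subgroup $\Lambda_c(G)$ by the subgroup $L=\mathrm{Aut}(G)\ltimes\mathrm{Hom}(G,\widehat{G})$ if and only if $G$ is a stem group.
   Context: The base field $\mathbbm{k}$ is algebraically closed of characteristic zero. For a finite group $G$, $\mathbbm{k}^G$ is the linear dual of $\mathbbm{k}G$, with dual basis $\{e_g\}_{g\in G}$ and identity $\varepsilon=\sum_{g}e_g$; $\widehat{G}=\mathrm{Hom}(G,\mathbbm{k}^\times)$ is the group of group-like elements of $\mathbbm{k}^G$. The Drinfeld double $\mathcal{D}(G)$ is the Hopf algebra with basis $e_g\# h$ ($g,h\in G$), multiplication $(e_g\# g')(e_h\# h')=\delta_{g,\,g'hg'^{-1}}\,e_g\# g'h'$, unit $\varepsilon\# 1$, and coalgebra structure $(\mathbbm{k}^G)^{\mathrm{cop}}\otimes\mathbbm{k}G$. $\mathrm{Aut}(\mathcal{D}(G))$ is its group of Hopf algebra automorphisms. Every Hopf algebra endomorphism $\psi$ of $\mathcal{D}(G)$ is determined by its components $(p,u,r,v)$, where $u(a)=(\mathrm{id}\otimes\varepsilon)\psi(a\#1)\in\mathbbm{k}^G$, $p(a)=(\mathrm{ev}_1\otimes\mathrm{id})\psi(a\#1)\in\mathbbm{k}G$, $r(g)=(\mathrm{id}\otimes\varepsilon)\psi(\varepsilon\#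 g)\in\widehat{G}$, $v(g)=(\mathrm{ev}_1\otimes\mathrm{id})\psi(\varepsilon\# g)\in G$ for $a\in\mathbbm{k}^G$, $g\in G$ (here $\mathrm{ev}_1(f)=f(1)$ and $\varepsilon$ in the second tensor factor is the counit of $\mathbbm{k}G$); one has $\psi(a\# g)=u(a_{(1)})r(g)\# p(a_{(2)})v(g)$, with Sweedler notation in $(\mathbbm{k}^G)^{\mathrm{cop}}$. $\Lambda_c(G)$ is the subgroup of all automorphisms with $v=\mathrm{id}$ and $r$ trivial ($r(g)=\varepsilon$ for all $g$). $L=\mathrm{Aut}(G)\ltimes\mathrm{Hom}(G,\widehat{G})$ is the subgroup of $\mathrm{Aut}(\mathcal{D}(G))$ generated by the automorphisms $e_g\# h\mapsto e_{v(g)}\# v(h)$ for $v\in\mathrm{Aut}(G)$ and $e_g\# h\mapsto r(h)e_g\# h$ for $r\in\mathrm{Hom}(G,\widehat{G})$. $G$ is a stem group if $Z(G)\leq G'$, where $G'$ is the derived subgroup. *)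

(* Defs.v *)
From HB Require Import structures.
From mathcomp Require Import all_boot all_order all_algebra.
From mathcomp Require Import all_fingroup all_solvable.
From mathcomp Require Import boolp classical_sets.

Set Implicit Arguments.
Unset Strict Implicit.
Unset Printing Implicit Defensive.

Import GRing.Theory.

(* The group G is the whole of a finGroupType gT; k^G and kG both have
   underlying space {ffun gT -> k^o}, and an element x of D(G) = k^G (x) kG is
   given by its coefficients: x (g, h) is the coefficient of e_g # h. *)
Definition double (k : fieldType) (gT : finGroupType) : Type :=
  {ffun gT * gT -> k^o}.

Section Algebra.
Local Open Scope ring_scope.
Variables (k : fieldType) (gT : finGroupType).
Local Notation D := (double k gT).

HB.instance Definition _ := Vector.copy D {ffun gT * gT -> k^o}.

(* dbasis (g, h) is e_g # h. *)
Definition dbasis (a : gT * gT) : D := [ffun b => (b == a)%:R].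

Definition dtens (a b : {ffun gT -> k^o}) : D := [ffun c => a c.1 * b c.2].

Definition dbasis_mul (a b : gT * gT) : D :=
  if a.1 == (a.2 * b.1 * a.2^-1)%g then dbasis (a.1, a.2 * b.2)%g else 0.

Definition dmul (x y : D) : D :=
  \sum_a \sum_b (x a * y b) *: dbasis_mul a b.

Definition funit : {ffun gT -> k^o} := [ffun=> 1].

Definition gbasis (g : gT) : {ffun gT -> k^o} := [ffun h => (h == g)%:R].

Definition dunit : D := dtens funit (gbasis 1%g).

Lemma dmulE (x y : D) g h :
  dmul x y (g, h) = \sum_s x (g, s) * y (g ^ s, s^-1 * h)%g.
Proof.
rewrite /dmul sum_ffunE.
under eq_bigr => a _ do rewrite sum_ffunE.
rewrite (eq_bigr (fun a : gT * gT => if a.1 == g then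
  x (g, a.2) * y (g ^ a.2, a.2^-1 * h)%g else 0)); last first.
  move=> [g1 s] _ /=.
  have [->|ng] := eqVneq g1 g; last first.
    rewrite big1 // => -[b1 b2] _; rewrite ffunE /dbasis_mul /=.
    case: ifP => _; rewrite ffunE ?scaler0 // xpair_eqE eq_sym (negbTE ng).
    by rewrite scaler0.
  rewrite (bigD1 (g ^ s, s^-1 * h)%g) //= big1 ?addr0; last first.
    move=> [b1 b2] nb; rewrite ffunE /dbasis_mul /=.
    case: ifP => [/eqP Eg|_]; rewrite ffunE ?scaler0 // xpair_eqE eqxx /=.
    case: eqP => [Eh|_]; last by rewrite scaler0.
    by case/negP: nb; rewrite Eg Eh conjgE !mulgA mulVg !mul1g mulgKV eqxx.
  rewrite ffunE /dbasis_mul /= conjgE !mulgA mulgV mul1g mulgK eqxx ffunE mul1g.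
  by rewrite eqxx /GRing.scale /= mulr1.
rewrite -(pair_bigA_idem _ (fun g1 s => if g1 == g then
  x (g, s) * y (g ^ s, s^-1 * h)%g else 0)) /= ?addr0 //.
rewrite (bigD1 g) //= [X in _ + X]big1 => [|i /negbTE ->]; last by rewrite big1.
by rewrite eqxx addr0.
Qed.

Lemma dunitE g h : dunit (g, h) = (h == 1%g)%:R.
Proof. by rewrite !ffunE mul1r. Qed.

Fact dmulA : associative dmul.
Proof.
move=> x y z; apply/ffunP => -[g h]; rewrite !dmulE.
under eq_bigr => s _ do rewrite dmulE mulr_sumr.
under [RHS]eq_bigr => s _ do rewrite dmulE mulr_suml.
rewrite [RHS]exchange_big /=; apply: eq_bigr => s _.
rewrite [RHS](reindex_inj (mulgI s)) /=; apply: eq_bigr => t _.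
by rewrite mulKg -mulrA conjgM invMg mulgA.
Qed.

Fact dmul1l : left_id dunit dmul.
Proof.
move=> x; apply/ffunP => -[g h]; rewrite dmulE (bigD1 1%g) //= dunitE eqxx.
rewrite conjg1 invg1 !mul1g mul1r big1 ?addr0 // => s /negbTE ns.
by rewrite dunitE ns mul0r.
Qed.

Fact dmul1r : right_id dunit dmul.
Proof.
move=> x; apply/ffunP => -[g h]; rewrite dmulE (bigD1 h) //= dunitE mulVg eqxx.
rewrite mulr1 big1 ?addr0 // => s ns.
by rewrite dunitE -eq_mulVg1 (negbTE ns) mulr0.
Qed.

Fact dmulDl : left_distributive dmul +%R.
Proof.
move=> x y z; apply/ffunP => -[g h]; rewrite ffunE !dmulE -big_split.
by apply: eq_bigr => s _; rewrite ffunE mulrDl.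
Qed.

Fact dmulDr : right_distributive dmul +%R.
Proof.
move=> x y z; apply/ffunP => -[g h]; rewrite ffunE !dmulE -big_split.
by apply: eq_bigr => s _; rewrite ffunE mulrDr.
Qed.

Fact dunit_neq0 : dunit != 0.
Proof.
apply/eqP => /ffunP /(_ (1, 1)%g); rewrite dunitE eqxx ffunE.
by apply/eqP/oner_neq0.
Qed.

HB.instance Definition _ := GRing.Zmodule_isNzRing.Build D
  dmulA dmul1l dmul1r dmulDl dmulDr dunit_neq0.

Fact dscaleAl (a : k) (x y : D) : a *: (x * y) = a *: x * y.
Proof.
apply/ffunP => -[g h]; rewrite ffunE !dmulE scaler_sumr.
by apply: eq_bigr => s _; rewrite ffunE scalerAl.
Qed.

HB.instance Definition _ := GRing.Lmodule_isLalgebra.Build k D dscaleAl.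

Fact dscaleAr (a : k) (x y : D) : a *: (x * y) = x * (a *: y).
Proof.
apply/ffunP => -[g h]; rewrite ffunE !dmulE scaler_sumr.
by apply: eq_bigr => s _; rewrite ffunE scalerAr.
Qed.

HB.instance Definition _ := GRing.Lalgebra_isAlgebra.Build k D dscaleAr.

End Algebra.

Section Coalgebra.
Local Open Scope ring_scope.
Variables (k : fieldType) (gT : finGroupType).
Local Notation D := (double k gT).

(* D (x) D, with coefficients on the basis (e_g # h) (x) (e_g' # h'). *)
Definition double2 : Type := {ffun (gT * gT) * (gT * gT) -> k^o}.
HB.instance Definition _ := Vector.copy double2
  {ffun (gT * gT) * (gT * gT) -> k^o}.

Definition tens (x y : D) : double2 := [ffun c => x c.1 * y c.2].

Definition tensmap (f : D -> D) (t : double2) : double2 :=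
  \sum_a \sum_b t (a, b) *: tens (f (dbasis k a)) (f (dbasis k b)).

(* In k^G, Delta e_g is the sum of the e_a (x) e_b with ab = g; the two factors
   are swapped here because of the co-opposite. *)
Definition dcomul (x : D) : double2 :=
  \sum_(c : gT * gT) x c *:
    \sum_(a : gT) \sum_(b : gT | (a * b)%g == c.1)
       tens (dbasis k (b, c.2)) (dbasis k (a, c.2)).

Definition dcounit (x : D) : k := \sum_(h : gT) x (1%g, h).

End Coalgebra.

(* Bialgebra maps between Hopf algebras commute with the antipodes, which
   therefore need not be mentioned. *)
Record is_hopf_aut (k : fieldType) (gT : finGroupType)
    (f : 'End(double k gT)) : Prop := IsHopfAut {
  hopf_aut_bij : bijective f;
  hopf_aut1 : f 1%R = 1%R;
  hopf_autM : {morph f : x y / (x * y)%R};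
  hopf_aut_comul : forall x, dcomul (f x) = tensmap f (dcomul x);
  hopf_aut_counit : forall x, dcounit (f x) = dcounit x }.

Structure hopfAut (k : fieldType) (gT : finGroupType) := HopfAut {
  hopf_aut_val :> 'End(double k gT);
  _ : `[< is_hopf_aut hopf_aut_val >] }.

Section HopfAutGroup.
Local Open Scope ring_scope.
Variables (k : fieldType) (gT : finGroupType).
Local Notation D := (double k gT).
Local Notation A := (hopfAut k gT).

HB.instance Definition _ := [isSub for @hopf_aut_val k gT].
HB.instance Definition _ := [Choice of A by <:].

Lemma hopf_autP (f : A) : is_hopf_aut f.
Proof. by case: f => f /= /asboolP. Qed.

Lemma dbasis_sum (x : D) : x = \sum_a x a *: dbasis k a.
Proof.
apply/ffunP => b; rewrite sum_ffunE (bigD1 b) //= big1 ?addr0 => [|a nab].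
  by rewrite !ffunE eqxx /GRing.scale /= mulr1.
by rewrite !ffunE eq_sym (negbTE nab) scaler0.
Qed.

Lemma tensmap_tens (f : 'End(D)) (x y : D) :
  tensmap f (tens x y) = tens (f x) (f y).
Proof.
apply/ffunP => c; rewrite /tensmap.
rewrite [in RHS](dbasis_sum x) [in RHS](dbasis_sum y) !linear_sum.
rewrite sum_ffunE [in RHS]ffunE !sum_ffunE mulr_suml; apply: eq_bigr => a _.
rewrite sum_ffunE mulr_sumr; apply: eq_bigr => b _.
by rewrite !linearZ !ffunE /GRing.scale /= mulrACA.
Qed.

Fact tensmap_is_linear (f : D -> D) : linear (@tensmap k gT f).
Proof.
move=> a s t; rewrite /tensmap scaler_sumr -big_split; apply: eq_bigr => b _.
rewrite scaler_sumr -big_split; apply: eq_bigr => c _ /=.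
by rewrite !ffunE scalerDl scalerA.
Qed.
HB.instance Definition _ (f : D -> D) :=
  GRing.isLinear.Build k (double2 k gT) (double2 k gT) _ (@tensmap k gT f)
    (tensmap_is_linear f).

Lemma tensmap_comp (f g : 'End(D)) t :
  tensmap (f \o g)%VF t = tensmap f (tensmap g t).
Proof.
rewrite [tensmap g t]/tensmap.
rewrite (linear_sum (@tensmap k gT f)); apply: eq_bigr => a _.
rewrite (linear_sum (@tensmap k gT f)); apply: eq_bigr => b _.
by rewrite (linearZ_LR (@tensmap k gT f)) /= tensmap_tens !lfunE.
Qed.

Lemma tensmap_id t : tensmap (\1%VF : 'End(D)) t = t.
Proof.
apply/ffunP => -[b c]; rewrite /tensmap pair_bigA /= sum_ffunE.
rewrite (bigD1 (b, c)) //= big1 ?addr0 => [|[a d] nad].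
  by rewrite !lfunE !ffunE !eqxx /GRing.scale /= !mulr1.
rewrite !lfunE !ffunE /= -natrM mulnb -xpair_eqE eq_sym (negbTE nad).
by rewrite scaler0.
Qed.

Fact hopf_aut_one : `[< is_hopf_aut (\1%VF : 'End(D)) >].
Proof.
apply/asboolP; split=> [||x y|x|x]; rewrite ?lfunE ?tensmap_id //.
by exists id => x; rewrite lfunE.
Qed.

Fact hopf_aut_comp (f g : A) : `[< is_hopf_aut (f \o g)%VF >].
Proof.
have [bf f1 fM fD fe] := hopf_autP f; have [bg g1 gM gD ge] := hopf_autP g.
apply/asboolP; split=> [||x y|x|x].
- apply: (eq_bij (bij_comp bf bg)) => x; by rewrite lfunE.
- by rewrite lfunE /= g1.
- by rewrite !lfunE /= gM fM.
- by rewrite lfunE /= fD gD tensmap_comp.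
- by rewrite lfunE /= fe ge.
Qed.

Lemma hopf_aut_ker (f : A) : lker f == 0%VS.
Proof. exact/lker0P/bij_inj/(hopf_aut_bij (hopf_autP f)). Qed.

Fact hopf_aut_inv (f : A) : `[< is_hopf_aut (f^-1)%VF >].
Proof.
have [bf f1 fM fD fe] := hopf_autP f; have kf := hopf_aut_ker f.
have fK := lker0_lfunK kf; have Kf := lker0_lfunVK kf.
apply/asboolP; split=> [||x y|x|x].
- by exists f.
- by rewrite -{1}f1 fK.
- by apply: (can_inj fK); rewrite fM !Kf.
- rewrite -{2}[x]Kf fD -tensmap_comp lker0_compVf //.
  by rewrite tensmap_id.
- by rewrite -fe Kf.
Qed.

Let one : A := HopfAut hopf_aut_one.
Let mul (f g : A) : A := HopfAut (hopf_aut_comp f g).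
Let inv (f : A) : A := HopfAut (hopf_aut_inv f).

Fact hopf_aut_mulA : associative mul.
Proof. by move=> f g h; apply: val_inj; rewrite /= comp_lfunA. Qed.
Fact hopf_aut_mul1l : left_id one mul.
Proof. by move=> f; apply: val_inj; rewrite /= comp_lfun1l. Qed.
Fact hopf_aut_mul1r : right_id one mul.
Proof. by move=> f; apply: val_inj; rewrite /= comp_lfun1r. Qed.
Fact hopf_aut_mulVl : left_inverse one inv mul.
Proof. by move=> f; apply/val_inj/lker0_compVf/hopf_aut_ker. Qed.
Fact hopf_aut_mulVr : right_inverse one inv mul.
Proof. by move=> f; apply/val_inj/lker0_compfV/hopf_aut_ker. Qed.

(* f * g is the composite f \o g. *)
HB.instance Definition _ := isGroup.Build A
  hopf_aut_mulA hopf_aut_mul1l hopf_aut_mul1r hopf_aut_mulVl hopf_aut_mulVr.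

End HopfAutGroup.

Section Components.
Local Open Scope ring_scope.
Variables (k : fieldType) (gT : finGroupType) (psi : hopfAut k gT).

(* r(g) = (id (x) epsilon) (psi (epsilon # g)), in k^G *)
Definition r_comp (g : gT) : {ffun gT -> k^o} :=
  [ffun a => \sum_(h : gT) psi (dtens (funit k gT) (gbasis k g)) (a, h)].

(* v(g) = (ev_1 (x) id) (psi (epsilon # g)), in kG *)
Definition v_comp (g : gT) : {ffun gT -> k^o} :=
  [ffun h => psi (dtens (funit k gT) (gbasis k g)) (1%g, h)].

End Components.

(* r is a homomorphism from G to Hom(G, k^* ), uncurried: r h 1 = 1 and
   multiplicativity make every r h x invertible. *)
Definition is_hom_dual (k : fieldType) (gT : finGroupType)
    (r : gT -> gT -> k) : Prop :=
  [/\ forall h, r h 1%g = 1%R,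
      forall h x y, r h (x * y)%g = (r h x * r h y)%R
    & forall h h' x, r (h * h')%g x = (r h x * r h' x)%R].

Definition stem_group (gT : finGroupType) : bool :=
  ('Z([set: gT]%SET) \subset [set: gT]%SET^`(1))%g.

Section Subgroups.
Local Open Scope classical_set_scope.
Local Open Scope group_scope.

Definition subgroup (A : groupType) (H : set A) : Prop :=
  [/\ H 1, forall x y, H x -> H y -> H (x * y) & forall x, H x -> H x^-1].

Definition normal_subgroup (A : groupType) (N : set A) : Prop :=
  subgroup N /\ forall x y, N x -> N (x ^ y).

Definition internal_sdprod (A : groupType) (N H : set A) : Prop :=
  [/\ normal_subgroup N, subgroup H, N `&` H = [set 1]
    & [set x * y | x in N & y in H] = setT].

Variables (k : fieldType) (gT : finGroupType).

Definition Lambda_c : set (hopfAut k gT) :=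
  [set psi | forall g, v_comp psi g = gbasis k g /\ r_comp psi g = funit k gT].

Definition Aut_gens : set (hopfAut k gT) :=
  [set psi | exists2 v, v \in Aut [set: gT]%SET &
     forall g h, psi (dbasis k (g, h)) = dbasis k (v g, v h)].

Definition Hom_gens : set (hopfAut k gT) :=
  [set psi | exists2 r : gT -> gT -> k, is_hom_dual r &
     forall g h, psi (dbasis k (g, h)) = (r h g *: dbasis k (g, h))%R].

Definition L_subgroup : set (hopfAut k gT) :=
  smallest (@subgroup _) (Aut_gens `|` Hom_gens).

End Subgroups.

Arguments Lambda_c : clear implicits.
Arguments L_subgroup : clear implicits.

(* Main.v *)
From HB Require Import structures.
Require Import Defs.
From mathcomp Require Import all_boot all_order all_algebra.
From mathcomp Require Import all_fingroup all_solvable.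
From mathcomp Require Import all_field all_character ring.
From mathcomp Require Import boolp classical_sets.

(* Write chi # g for the group-like element with chi in Hom(G, k^* ); these are
   the only group-likes of D(G).

   Suppose G is stem and let c be in Lambda_c, with components p and u.  Since u
   is invertible, comultiplicativity of c forces p(e_x) = p(e_(bxb^-1)); as the
   p(e_x) are orthogonal idempotents, p(e_x) = 0 unless x is central, and dually
   p(e_x) is supported on Z(G).  Hence u is the transpose of a central
   automorphism.  Characters are trivial on Z(G) <= G', so c fixes every chi # 1,
   hence every group-like element; as psi (1 # g) is group-like for all
   automorphisms psi, Lambda_c is normal.  Moreover v has v(G) Z(G) = G, so v(G)
   contains G' >= Z(G) and v is an automorphism; psi then agrees on 1 # G with an
   element of L.

   Conversely, given z in Z(G) outside G', some r in Hom(G, \hat G) has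
   r(g)(z) <> 1.  A Fourier kernel on <z> provides an element of Lambda_c with
   p(r(g)) <> 1, and conjugating it by r leaves Lambda_c. *)

Set Implicit Arguments.
Unset Strict Implicit.
Unset Printing Implicit Defensive.

Import GRing.Theory.
Local Open Scope ring_scope.

(** * Delta sums and orthogonal idempotents *)

Lemma sum_delta (V : zmodType) (I : finType) (i0 : I) (F : I -> V) :
  (forall i, i != i0 -> F i = 0) -> \sum_i F i = F i0.
Proof.
by move=> F0; rewrite (bigD1 i0) //= big1 ?addr0.
Qed.

Section IdempotentFamily.
Variables (k : fieldType) (I : finType) (f : I -> k).
Hypothesis f_orth : forall i j, f i * f j = (i == j)%:R * f i.
Hypothesis f_sum : \sum_i f i = 1.

(** Some [f i0] is nonzero because the sum is 1; idempotence then gives [f i0 = 1], and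
    orthogonality to [f i0] kills the rest. Below, this extracts group elements from matrix
    coefficients. *)
Lemma orth_idem_point : exists i0, forall i, f i = (i == i0)%:R.
Proof.
have /existsP[i0 nz]: [exists i, f i != 0].
  apply/contraT; rewrite negb_exists => /forallP f0; move/eqP: f_sum.
  by rewrite big1 => [|i _]; [rewrite eq_sym oner_eq0 | apply/eqP; rewrite -[_ == _]negbK].
exists i0 => i; have := f_orth i i0; have [->|_] := eqVneq i i0.
  by rewrite mul1r -{3}[f i0]mulr1 => /(mulfI nz).
by rewrite mul0r => /eqP; rewrite mulf_eq0 (negbTE nz) orbF => /eqP.
Qed.

End IdempotentFamily.

(** * Coefficients and group-like elements *)

Section Double.
Variables (k : fieldType) (gT : finGroupType).
Local Notation D := (Defs.double k gT).
Local Notation A := (hopfAut k gT).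
Implicit Types (x y g h b s t : gT) (X Y : D) (chi : gT -> k).

(* Coefficients are read in k rather than in the left module k^o over itself. *)
Definition dcoef X g h : k := X (g, h).

Definition dcoef2 (T : double2 k gT) g h g' h' : k := T ((g, h), (g', h')).

Lemma dcoef_ext X Y : (forall g h, dcoef X g h = dcoef Y g h) -> X = Y.
Proof. by move=> E; apply/ffunP => -[g h]; apply: E. Qed.

Lemma dcoef2_ext T T' :
  (forall g h g' h', dcoef2 T g h g' h' = dcoef2 T' g h g' h') -> T = T'.
Proof. by move=> E; apply/ffunP => -[[g h] [g' h']]; apply: E. Qed.

Lemma dcoefZ (a : k) X g h : dcoef (a *: X) g h = a * dcoef X g h.
Proof. by rewrite /dcoef ffunE. Qed.

Lemma dcoef_sum (I : finType) (P : pred I) (F : I -> D) g h :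
  dcoef (\sum_(i | P i) F i) g h = \sum_(i | P i) dcoef (F i) g h.
Proof. by rewrite /dcoef sum_ffunE. Qed.

Lemma dcoef2Z (a : k) T g h g' h' : dcoef2 (a *: T) g h g' h' = a * dcoef2 T g h g' h'.
Proof. by rewrite /dcoef2 ffunE. Qed.

Lemma dcoef2_sum (I : finType) (P : pred I) (F : I -> double2 k gT) g h g' h' :
  dcoef2 (\sum_(i | P i) F i) g h g' h' = \sum_(i | P i) dcoef2 (F i) g h g' h'.
Proof. by rewrite /dcoef2 sum_ffunE. Qed.

Lemma dcoef_basis g h x y : dcoef (dbasis k (g, h)) x y = ((x == g) && (y == h))%:R.
Proof. by rewrite /dcoef ffunE xpair_eqE. Qed.

Lemma dcoef2_tens X Y g h g' h' :
  dcoef2 (tens X Y) g h g' h' = dcoef X g h * dcoef Y g' h'.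
Proof. by rewrite /dcoef2 ffunE. Qed.

Lemma dcoefM X Y g h :
  dcoef (X * Y) g h = \sum_s dcoef X g s * dcoef Y (g ^ s)%g (s^-1 * h)%g.
Proof. exact: dmulE. Qed.

Lemma dbasisM (g h g' h' : gT) :
  dbasis k (g, h) * dbasis k (g', h') =
  (g == (h * g' * h^-1)%g)%:R *: dbasis k (g, (h * h')%g).
Proof.
rewrite [LHS](_ : _ = dmul (dbasis k (g, h)) (dbasis k (g', h'))) //.
rewrite /dmul (sum_delta (i0 := (g, h))) => [|a na]; last first.
  by rewrite big1 // => b _; rewrite ffunE (negbTE na) mul0r scale0r.
rewrite (sum_delta (i0 := (g', h'))) => [|a na]; last first.
  by rewrite [dbasis k (g', h') a]ffunE (negbTE na) mulr0 scale0r.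
rewrite !ffunE !eqxx mulr1 scale1r /dbasis_mul /=.
by case: ifP => _; rewrite ?scale1r ?scale0r.
Qed.

(** The product is [y' * y], in this order, because of the co-opposite. *)
Lemma dcoef2_comul X (y h y' h' : gT) :
  dcoef2 (dcomul X) y h y' h' = (h == h')%:R * dcoef X (y' * y)%g h.
Proof.
rewrite /dcomul dcoef2_sum (sum_delta (i0 := (y' * y, h)%g)).
  rewrite dcoef2Z dcoef2_sum (sum_delta (i0 := y')) => [|i ni]; last first.
    rewrite dcoef2_sum big1 // => j _.
    by rewrite dcoef2_tens !dcoef_basis [y' == i]eq_sym (negbTE ni) mulr0.
  rewrite dcoef2_sum (bigD1 y) //= big1 => [|j /andP[_ nj]].
    by rewrite dcoef2_tens !dcoef_basis !eqxx /= addr0 mul1r [h' == h]eq_sym mulrC.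
  by rewrite dcoef2_tens !dcoef_basis [y == j]eq_sym (negbTE nj) mul0r.
move=> [c1 c2] nc; rewrite dcoef2Z dcoef2_sum big1 ?mulr0 // => i _.
rewrite dcoef2_sum big1 // => j /eqP Eij; rewrite dcoef2_tens !dcoef_basis /=.
case: eqP => [Ey|]; rewrite ?mul0r //; case: eqP => [Eh|]; rewrite ?mul0r //.
case: eqP => [Ey'|]; rewrite ?mulr0 //.
by case/eqP: nc; rewrite Ey Eh Ey'; congr (_, _); apply/esym.
Qed.

Lemma dcomul_basis g h :
  dcomul (dbasis k (g, h)) =
  \sum_b tens (dbasis k (b, h)) (dbasis k (g * b^-1, h)%g).
Proof.
apply/dcoef2_ext => y s y' s'; rewrite dcoef2_comul dcoef_basis dcoef2_sum.
rewrite (sum_delta (i0 := y)) => [|b nb]; rewrite dcoef2_tens !dcoef_basis; last first.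
  by rewrite [y == b]eq_sym (negbTE nb) mul0r.
rewrite eqxx -!natrM !mulnb andTb -(inj_eq (mulIg y) y' (g * y^-1)%g) mulgKV.
case: (s =P s') => [->|ns] /=; first by congr (_%:R); case: (s' == h); rewrite ?andbT ?andbF.
case: (s =P h) => [Es|]; rewrite ?andbF //=.
by case: (s' =P h) => [E|]; rewrite ?andbF //; case: ns; rewrite E.
Qed.

(** The element [chi # g], that is, the sum over x of [chi x] times e_x # g. *)
Definition glike chi g : D := [ffun c => (chi c.1 * (c.2 == g)%:R : k)].

(** These conditions force nonzero values, so they describe the homomorphisms from G to the units of
    k. *)
Definition is_char chi :=
  chi 1%g = 1 /\ forall x y, chi (x * y)%g = chi x * chi y.

Lemma dcoef_glike chi g x y : dcoef (glike chi g) x y = chi x * (y == g)%:R.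
Proof. by rewrite /dcoef ffunE. Qed.

Lemma eq_glike chi chi' g : chi =1 chi' -> glike chi g = glike chi' g.
Proof. by move=> E; apply/dcoef_ext => x y; rewrite !dcoef_glike E. Qed.

Lemma is_char1 : is_char (fun=> 1).
Proof. by split=> // x y; rewrite mulr1. Qed.

Lemma is_charJ chi x y : is_char chi -> chi (x ^ y)%g = chi x.
Proof.
by move=> [c1 cM]; rewrite conjgE !cM mulrCA -cM mulVg c1 mulr1.
Qed.

Lemma glikeM chi chi' g h : is_char chi' ->
  glike chi g * glike chi' h = glike (fun x => chi x * chi' x) (g * h)%g.
Proof.
move=> c'; apply/dcoef_ext => x y; rewrite dcoefM (sum_delta (i0 := g)).
  rewrite !dcoef_glike eqxx mulr1 is_charJ // mulrA.
  by rewrite -(inj_eq (mulgI g) (g^-1 * y)%g h) mulKVg.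
by move=> s ns; rewrite !dcoef_glike (negbTE ns) mulr0 mul0r.
Qed.

Lemma glike_inj chi chi' g h : is_char chi -> is_char chi' ->
  glike chi g = glike chi' h -> chi =1 chi' /\ g = h.
Proof.
move=> [c1 _] [c'1 _] E; have Egh: g = h.
  move/(congr1 (fun X => dcoef X 1%g g)): E; rewrite !dcoef_glike c1 c'1 eqxx !mul1r.
  by case: eqP => // _ /eqP; rewrite oner_eq0.
split=> // x; move/(congr1 (fun X => dcoef X x g)): E.
by rewrite !dcoef_glike Egh eqxx !mulr1.
Qed.

Lemma embed_glike g : dtens (funit k gT) (gbasis k g) = glike (fun=> 1) g.
Proof. by apply/ffunP => x; rewrite !ffunE. Qed.

Lemma glike1 : glike (fun=> 1) 1%g = 1.
Proof. by rewrite -embed_glike. Qed.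

Lemma dcomul_glike chi g : is_char chi ->
  dcomul (glike chi g) = tens (glike chi g) (glike chi g).
Proof.
move=> [_ cM]; apply/dcoef2_ext => y s y' s'.
rewrite dcoef2_comul dcoef2_tens !dcoef_glike cM [chi y' * _]mulrC.
have [->|ns] := eqVneq s s'; first by case: eqP => _ /=; rewrite !(mulr1, mul1r, mulr0).
rewrite mul0r; have [E|_] := eqVneq s g; last by rewrite mulr0 mul0r.
by rewrite eq_sym E in ns; rewrite (negbTE ns) !mulr0.
Qed.

Lemma dcounitE X : dcounit X = \sum_h dcoef X 1%g h.
Proof. by []. Qed.

Lemma dcounit_glike chi g : is_char chi -> dcounit (glike chi g) = 1.
Proof.
move=> [c1 _]; rewrite dcounitE (sum_delta (i0 := g)) => [|h nh].
  by rewrite dcoef_glike c1 eqxx mulr1.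
by rewrite dcoef_glike (negbTE nh) mulr0.
Qed.

(** The coefficients at [y = 1] are orthogonal idempotents with sum 1, hence concentrated at one
    [g]. Multiplying by them kills every other column, and the column of [g] is multiplicative. *)
Lemma grouplikeP X : dcomul X = tens X X -> dcounit X = 1 ->
  exists chi g, is_char chi /\ X = glike chi g.
Proof.
move=> XX X1; have XE y h y' h' :
    dcoef X y h * dcoef X y' h' = (h == h')%:R * dcoef X (y' * y)%g h.
  by rewrite -dcoef2_comul XX dcoef2_tens.
have [g gE] : exists g, forall h, dcoef X 1%g h = (h == g)%:R.
  by apply: orth_idem_point => // i j; rewrite XE mulg1.
have X0 y h : h != g -> dcoef X y h = 0.
  move=> nh; have := XE y h 1%g h; rewrite mul1g eqxx mul1r gE (negbTE nh).
  by rewrite mulr0.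
exists (fun y => dcoef X y g), g; split.
  by split=> [|x y]; rewrite ?gE ?eqxx // mulrC XE eqxx mul1r.
apply/dcoef_ext => x y; rewrite dcoef_glike.
by have [->|ny] := eqVneq y g; rewrite ?mulr1 // mulr0 X0.
Qed.

Lemma aut_glike (f : A) chi g : is_char chi ->
  exists chi' g', is_char chi' /\ f (glike chi g) = glike chi' g'.
Proof.
have [_ _ _ fD fe] := hopf_autP f => c; apply: grouplikeP.
  by rewrite fD dcomul_glike // tensmap_tens.
by rewrite fe dcounit_glike.
Qed.

Lemma autM (f : A) X Y : f (X * Y) = f X * f Y.
Proof. by have [_ _ -> _ _] := hopf_autP f. Qed.

Lemma mul_autE (f f' : A) X : (f * f')%g X = f (f' X).
Proof. exact: lfunE. Qed.

Lemma one_autE X : (1%g : A) X = X.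
Proof. exact: id_lfunE. Qed.

Lemma aut_inj (f : A) : injective f.
Proof. by have [bf _ _ _ _] := hopf_autP f; apply: bij_inj. Qed.

Lemma autKV (f : A) X : f (f^-1%g X) = X.
Proof. by rewrite -mul_autE mulgV one_autE. Qed.

Lemma autVK (f : A) X : f^-1%g (f X) = X.
Proof. by rewrite -mul_autE mulVg one_autE. Qed.

Lemma aut_eqP (f f' : A) : (forall X, f X = f' X) -> f = f'.
Proof. by move=> E; apply/val_inj/lfunP. Qed.

Lemma aut_basis_eq (f f' : A) :
  (forall g h, f (dbasis k (g, h)) = f' (dbasis k (g, h))) -> f = f'.
Proof.
move=> E; apply: aut_eqP => X; rewrite (dbasis_sum X) !linear_sum.
by apply: eq_bigr => -[g h] _; rewrite !linearZ /= E.
Qed.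

Lemma v_compE (f : A) g h : v_comp f g h = dcoef (f (glike (fun=> 1) g)) 1%g h :> k.
Proof. by rewrite ffunE embed_glike. Qed.

Lemma r_compE (f : A) g x :
  r_comp f g x = \sum_h dcoef (f (glike (fun=> 1) g)) x h :> k.
Proof. by rewrite ffunE embed_glike. Qed.

(** The image of [1 # g] is a group-like [chi # h]; [v_comp] recovers [h] and [r_comp] recovers
    [chi], so the two components determine it. *)
Lemma Lambda_cP (f : A) :
  Lambda_c k gT f <-> forall g, f (glike (fun=> 1) g) = glike (fun=> 1) g.
Proof.
split=> [Lf g|fg g]; last first.
  split; apply/ffunP => x; rewrite (v_compE, r_compE) fg ffunE.
    by rewrite dcoef_glike mul1r.
  rewrite (sum_delta (i0 := g)) => [|h nh]; rewrite dcoef_glike mul1r ?eqxx //.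
  by rewrite (negbTE nh).
have [vg rg] := Lf g; have [chi [h [[c1 cM] E]]] := aut_glike f g is_char1.
have Ehg: h = g.
  have := congr1 (fun u : {ffun gT -> k^o} => u h : k) vg.
  rewrite v_compE E dcoef_glike c1 ffunE eqxx mulr1.
  by case: eqP => // _ /eqP; rewrite oner_eq0.
rewrite E Ehg; apply: eq_glike => x.
have := congr1 (fun u : {ffun gT -> k^o} => u x : k) rg.
rewrite r_compE ffunE E Ehg (sum_delta (i0 := g)) => [|s ns].
  by rewrite dcoef_glike eqxx mulr1.
by rewrite dcoef_glike (negbTE ns) mulr0.
Qed.

Lemma Lambda_c_subgroup : subgroup (Lambda_c k gT).
Proof.
split=> [|f f' /Lambda_cP Lf /Lambda_cP Lf'|f /Lambda_cP Lf]; apply/Lambda_cP => g.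
- by rewrite one_autE.
- by rewrite mul_autE Lf' Lf.
- by rewrite -{1}Lf autVK.
Qed.

End Double.

(** * Products with group-likes and expansions in the basis *)

Section Multiplication.
Variables (k : fieldType) (gT : finGroupType).
Local Notation D := (Defs.double k gT).
Local Notation A := (hopfAut k gT).
Implicit Types (x y g h b s t : gT) (X Y : D) (chi : gT -> k).

Lemma dcoef_glikeMl X g y h :
  dcoef (glike (fun=> 1) g * X) y h = dcoef X (y ^ g)%g (g^-1 * h)%g.
Proof.
rewrite dcoefM (sum_delta (i0 := g)) => [|s ns]; rewrite dcoef_glike.
  by rewrite eqxx !mul1r.
by rewrite (negbTE ns) mulr0 mul0r.
Qed.

Lemma dcoef_glikeMr X g y h :
  dcoef (X * glike (fun=> 1) g) y h = dcoef X y (h * g^-1)%g.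
Proof.
rewrite dcoefM (sum_delta (i0 := (h * g^-1)%g)) => [|s ns]; rewrite dcoef_glike.
  by rewrite invMg invgK mulgKV eqxx !mulr1.
rewrite [_ == g](_ : _ = false) ?mulr0 //; apply: contraNF ns => /eqP <-.
by rewrite invMg invgK mulVKg.
Qed.

Lemma dbasis_glikeM x h : dbasis k (x, h) = dbasis k (x, 1%g) * glike (fun=> 1) h.
Proof.
apply: dcoef_ext => y t; rewrite dcoef_glikeMr !dcoef_basis.
by rewrite -(inj_eq (mulIg h) _ 1%g) mulgKV mul1g.
Qed.

Lemma dcoef_lin (f : 'End(D)) X y h :
  dcoef (f X) y h = \sum_x \sum_g dcoef X x g * dcoef (f (dbasis k (x, g))) y h.
Proof.
rewrite {1}(dbasis_sum X) linear_sum dcoef_sum pair_bigA.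
by apply: eq_bigr => -[x g] _; rewrite linearZ dcoefZ.
Qed.

Lemma tensmap_comul_basis (f : 'End(D)) x h :
  tensmap f (dcomul (dbasis k (x, h))) =
  \sum_b tens (f (dbasis k (b, h))) (f (dbasis k (x * b^-1, h)%g)).
Proof.
rewrite dcomul_basis (linear_sum (@tensmap k gT f)).
by apply: eq_bigr => b _; rewrite /= tensmap_tens.
Qed.

Lemma sum_dbasis1 : \sum_x dbasis k (x, 1%g : gT) = glike (fun=> 1) 1%g.
Proof.
apply: dcoef_ext => y h; rewrite dcoef_glike dcoef_sum mul1r.
rewrite (sum_delta (i0 := y)) => [|x nx]; rewrite dcoef_basis ?eqxx //.
by rewrite eq_sym (negbTE nx).
Qed.

End Multiplication.

(** * The center and the characters *)

Section Center.
Variable gT : finGroupType.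
Implicit Types x y z g : gT.

Lemma centerTP z : reflect (forall g, z ^ g = z)%g (z \in 'Z([set: gT])%g).
Proof.
apply: (iffP idP) => [/centerP[_ cz] g|fixz].
  by rewrite conjgE cz ?inE // mulKg.
by apply/centerP; split=> [|g _]; rewrite ?inE //; apply/commgP/conjg_fixP.
Qed.

Lemma center_conj z g : z \in 'Z([set: gT])%g -> (g ^ z)%g = g.
Proof. by move=> /centerTP fixz; apply/conjg_fixP/commgP/commute_sym/commgP/conjg_fixP. Qed.

Lemma is_char_ker_der1 (k : fieldType) (chi : gT -> k) x :
  is_char chi -> x \in [set: gT]^`(1)%g -> chi x = 1.
Proof.
move=> cchi; have [c1 cM] := cchi.
have gK : group_set [set y | chi y == 1].
  apply/group_setP; split=> [|y z]; rewrite !inE ?c1 // => /eqP cy /eqP cz.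
  by rewrite cM cy cz mulr1.
suff: [set: gT]^`(1)%g \subset Group gK by move/fintype.subsetP=> s /s; rewrite inE => /eqP.
rewrite derg1 gen_subG; apply/fintype.subsetP => _ /imset2P[y z _ _ ->].
by rewrite inE commgEl cM is_charJ // -cM mulVg c1.
Qed.

Lemma stem_char_center (k : fieldType) (chi : gT -> k) z :
  stem_group gT -> is_char chi -> z \in 'Z([set: gT])%g -> chi z = 1.
Proof. by move=> /fintype.subsetP ZG' cchi /ZG'; apply: is_char_ker_der1. Qed.

End Center.

(** * Elements of Lambda_c over a stem group *)

Section KeyLemma.
Variables (k : fieldType) (gT : finGroupType).
Local Notation D := (Defs.double k gT).
Local Notation A := (hopfAut k gT).
Implicit Types (x y g h b s t : gT) (X Y : D) (chi : gT -> k).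

(** The value at [y] of the k^G-component of [X], obtained by applying the counit of kG to the
    second factor. *)
Definition slice X y : k := \sum_h dcoef X y h.

(* The k^G-component of c (a # g) does not depend on g when c is in Lambda_c, so
   c induces an endomorphism of k^G, inverse to the one induced by c^-1. *)
Lemma slice_Lambda_c0 (c : A) X : Lambda_c k gT c ->
  (forall y, slice X y = 0) -> forall y, slice (c X) y = 0.
Proof.
move=> /Lambda_cP Lc X0 y; rewrite /slice.
under eq_bigr => h _ do rewrite dcoef_lin.
rewrite exchange_big big1 // => x _; rewrite exchange_big.
transitivity (\sum_g dcoef X x g * slice (c (dbasis k (x, 1%g))) y).
  apply: eq_bigr => g _; rewrite -mulr_sumr; congr (_ * _); rewrite /slice.
  rewrite [RHS](reindex_inj (mulIg g^-1%g)); apply: eq_bigr => h _.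
  by rewrite dbasis_glikeM autM Lc dcoef_glikeMr.
by rewrite -mulr_suml [X in X * _](X0 x) mul0r.
Qed.

Variables (c : A).
Hypothesis Lc : Lambda_c k gT c.

(** [C x] holds the coefficients of c(e_x # 1); [P] and [U] are the matrices of the components p and
    u of [c]. *)
Let C x y h := dcoef (c (dbasis k (x, 1%g))) y h.
Let P x h := C x 1%g h.
Let U x y := \sum_h C x y h.

(** This is injectivity of u: the relation makes the k^G-component of [c X] vanish, and [c^-1],
    again in Lambda_c, carries this back to [X]. *)
Lemma U_inj (a : gT -> k) :
  (forall y, \sum_b a b * U b y = 0) -> forall b, a b = 0.
Proof.
move=> a0 b; pose X := \sum_b a b *: dbasis k (b, 1%g : gT).
have cX0 y : slice (c X) y = 0.
  rewrite -[RHS](a0 y) /slice /X linear_sum.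
  under eq_bigr => h _ do rewrite dcoef_sum.
  rewrite exchange_big; apply: eq_bigr => x _; rewrite mulr_sumr.
  by apply: eq_bigr => h _; rewrite linearZ dcoefZ.
have [_ _ LV] := Lambda_c_subgroup k gT.
have := slice_Lambda_c0 (LV c Lc) cX0 b; rewrite autVK /slice.
rewrite (sum_delta (i0 := 1%g)) => [|h nh]; rewrite dcoef_sum.
  rewrite (sum_delta (i0 := b)) => [|x nx]; rewrite dcoefZ dcoef_basis.
    by rewrite !eqxx mulr1.
  by rewrite eq_sym (negbTE nx) mulr0.
by rewrite big1 // => x _; rewrite dcoefZ dcoef_basis (negbTE nh) andbF mulr0.
Qed.

Lemma C_comul x y h y' h' :
  \sum_b C b y h * C (x * b^-1)%g y' h' = (h == h')%:R * C x (y' * y)%g h.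
Proof.
have [_ _ _ cD _] := hopf_autP c; rewrite -dcoef2_comul cD tensmap_comul_basis.
by rewrite dcoef2_sum; apply: eq_bigr => b _; rewrite dcoef2_tens.
Qed.

Lemma C_mul x x' y h :
  \sum_s C x y s * C x' (y ^ s)%g (s^-1 * h)%g = (x == x')%:R * C x y h.
Proof.
by rewrite -dcoefM -autM dbasisM mul1g invg1 !mulg1 linearZ dcoefZ.
Qed.

Lemma C_unit y h : \sum_x C x y h = (h == 1%g)%:R.
Proof.
have /Lambda_cP fix1 := Lc.
by rewrite -dcoef_sum -linear_sum /= sum_dbasis1 fix1 dcoef_glike mul1r.
Qed.

(** Since [c] fixes [1 # g], it commutes with conjugation by it. *)
Lemma C_conj x y h g : C (x ^ g)%g (y ^ g)%g (h ^ g)%g = C x y h.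
Proof.
have /Lambda_cP fix1 := Lc.
have: glike (fun=> 1) g * dbasis k ((x ^ g)%g, 1%g)
      = dbasis k (x, 1%g) * glike (fun=> 1) g.
  apply: dcoef_ext => s t; rewrite dcoef_glikeMl dcoef_glikeMr !dcoef_basis.
  rewrite (inj_eq (@conjg_inj _ g)) -(inj_eq (mulgI g) _ 1%g) mulKVg mulg1.
  by rewrite -(inj_eq (mulIg g) _ 1%g) mulgKV mul1g.
move/(congr1 (fun X => dcoef (c X) y (h * g)%g)); rewrite /= !autM fix1.
by rewrite dcoef_glikeMl dcoef_glikeMr mulgK -conjgE.
Qed.

(** This is c(a # 1) = u(a_(1)) # p(a_(2)) in coefficients: [C_comul] at [y' = 1], summed over the
    first kG-coordinate. *)
Lemma C_split x y h : C x y h = \sum_b U b y * P (x * b^-1)%g h.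
Proof.
under eq_bigr => b _ do rewrite mulr_suml.
rewrite exchange_big (sum_delta (i0 := h)) => [|s ns]; rewrite C_comul.
  by rewrite eqxx mul1r mul1g.
by rewrite (negbTE ns) mul0r.
Qed.

(** Here [C_comul] is used with 1 as the other k^G-coordinate, so the factors p and u trade places;
    after reindexing, only the side of [b^-1] differs from [C_split]. *)
Lemma C_split' x y h : C x y h = \sum_b U b y * P (b^-1 * x)%g h.
Proof.
transitivity (\sum_b P b h * U (x * b^-1)%g y).
  under eq_bigr => b _ do rewrite mulr_sumr.
  rewrite exchange_big (sum_delta (i0 := h)) => [|s ns]; rewrite C_comul.
    by rewrite eqxx mul1r mulg1.
  by rewrite eq_sym (negbTE ns) mul0r.
rewrite (reindex_inj (h := fun b => b^-1 * x)%g) => [|b b' /mulIg /invg_inj //].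
by apply: eq_bigr => b _; rewrite mulrC invMg invgK mulVKg.
Qed.

(** Subtracting the two splittings of [C (x * g)] gives a linear relation between the rows of [U],
    so its coefficients vanish by [U_inj]; at [b = g] they compare [P x] with [P (x ^ g)]. *)
Lemma P_conjl x h g : P (x ^ g)%g h = P x h.
Proof.
apply/esym/eqP; rewrite -subr_eq0; apply/eqP.
have := U_inj (a := fun b => P (x * g * b^-1)%g h - P (b^-1 * (x * g))%g h) _ g.
rewrite mulgK -conjgE; apply=> y.
under eq_bigr => b _ do rewrite mulrBl mulrC [X in _ - X]mulrC.
by rewrite sumrB -C_split -C_split' subrr.
Qed.

Lemma P_conjr x h g : P x (h ^ g)%g = P x h.
Proof. by rewrite -(P_conjl x _ g) /P -{1}(conj1g g) C_conj. Qed.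

(** If [x ^ g] differs from [x], then p(e_x) and p(e_(x^g)) are orthogonal idempotents, yet equal by
    [P_conjl], hence zero. The second half is the dual argument, with comultiplication and
    [P_conjr]. *)
Lemma P_center x h :
  P x h != 0 -> (x \in 'Z([set: gT])%g) && (h \in 'Z([set: gT])%g).
Proof.
move=> nz; apply/andP; split; apply/centerTP => g; apply/eqP; apply: contraNT nz => ng.
  have /= := C_mul x (x ^ g)%g 1%g h; rewrite eq_sym (negbTE ng) mul0r => <-.
  have := C_mul x x 1%g h; rewrite eqxx mul1r /P => <-.
  by apply/eqP/eq_bigr => s _; rewrite conj1g -/(P _ _) -[in RHS]/(P _ _) P_conjl.
have := C_comul x 1%g h 1%g (h ^ g)%g; rewrite eq_sym (negbTE ng) mul0r => <-.
have := C_comul x 1%g h 1%g h; rewrite mulg1 eqxx mul1r /P => <-.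
by apply/eqP/eq_bigr => b _; rewrite -[in RHS]/(P _ (h ^ g)%g) P_conjr.
Qed.

Lemma C_center x y h : C x y h != 0 -> h \in 'Z([set: gT])%g.
Proof.
apply: contraR => nh; rewrite C_split big1 // => b _.
have [->|/P_center/andP[_ zh]] := eqVneq (P (x * b^-1)%g h) 0; first by rewrite mulr0.
by rewrite zh in nh.
Qed.

(** In the product, the kG-part [s] of the first factor conjugates the k^G-part of the second; as
    only central [s] occur, u is multiplicative. *)
Lemma U_orth x x' y : U x y * U x' y = (x == x')%:R * U x y.
Proof.
transitivity (\sum_h \sum_s C x y s * C x' (y ^ s)%g (s^-1 * h)%g); last first.
  by rewrite mulr_sumr; apply: eq_bigr => h _; rewrite C_mul.
rewrite exchange_big mulr_suml; apply: eq_bigr => s _ /=.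
have [->|/C_center zs] := eqVneq (C x y s) 0.
  by rewrite mul0r big1 // => h _; rewrite mul0r.
rewrite -mulr_sumr [in RHS](reindex_inj (mulgI s)); congr (_ * _).
by apply: eq_bigr => h _; rewrite mulKg center_conj.
Qed.

Lemma U_sum y : \sum_x U x y = 1.
Proof.
rewrite exchange_big (sum_delta (i0 := 1%g)) => [|h nh]; rewrite C_unit ?eqxx //.
by rewrite (negbTE nh).
Qed.

(** For fixed [y] the [U x y] are orthogonal idempotents with sum 1, so they single out one [tau y].
    This [tau] is multiplicative by [C_comul], commutes with conjugation by [C_conj] and is onto by
    [U_inj]; together these make it central. *)
Lemma U_central_aut : exists tau : gT -> gT,
  (forall x y, U x y = (x == tau y)%:R) /\
  forall y, (y^-1 * tau y)%g \in 'Z([set: gT])%g.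
Proof.
have /choice[tau tauE] : forall y, exists t, forall x, U x y = (x == t)%:R.
  by move=> y; apply: orth_idem_point; [move=> i j; apply: U_orth | apply: U_sum].
exists tau; split=> // y.
have tauM y1 y2 : tau (y1 * y2)%g = (tau y1 * tau y2)%g.
  (* Summing over [h] and [h'] applies the counit of kG to both tensor factors; only [b = tau y2]
     will contribute, and it contributes 1. *)
  have E : \sum_h \sum_h' \sum_b C b y2 h * C (tau y1 * tau y2 * b^-1)%g y1 h'
           = U (tau y1 * tau y2)%g (y1 * y2)%g.
    under eq_bigr => h _ do under eq_bigr => h' _ do rewrite C_comul.
    apply: eq_bigr => h _; rewrite (sum_delta (i0 := h)) ?eqxx ?mul1r // => h' nh'.
    by rewrite eq_sym (negbTE nh') mul0r.
  have: U (tau y1 * tau y2)%g (y1 * y2)%g = 1.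
    rewrite -E; under eq_bigr => h _ do rewrite exchange_big.
    rewrite exchange_big (sum_delta (i0 := tau y2)) => [|b nb] /=.
      under eq_bigr => h _ do rewrite -mulr_sumr.
      by rewrite -mulr_suml mulgK -!/(U _ _) !tauE !eqxx mulr1.
    under eq_bigr => h _ do rewrite -mulr_sumr.
    by rewrite -mulr_suml -!/(U _ _) !tauE (negbTE nb) mul0r.
  by rewrite tauE; case: eqP => // _ /eqP; rewrite eq_sym oner_eq0.
have tauJ x g : tau (x ^ g)%g = (tau x ^ g)%g.
  have: U (tau x ^ g)%g (x ^ g)%g = 1.
    rewrite /U (reindex_inj (@conjg_inj _ g)).
    under eq_bigr => h _ do rewrite C_conj.
    by rewrite -/(U _ _) tauE eqxx.
  by rewrite tauE; case: eqP => // _ /eqP; rewrite eq_sym oner_eq0.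
have tau_surj x : exists y, tau y = x.
  apply/not_existsP => nx.
  have F : forall z, \sum_b (b == x)%:R * U b z = 0.
    move=> z; rewrite (sum_delta (i0 := x)) ?eqxx ?mul1r => [|b /negbTE->].
      by rewrite tauE; case: eqP => // E; case: (nx z).
    by rewrite mul0r.
  by have /eqP := U_inj (a := fun b => (b == x)%:R) F x; rewrite eqxx oner_eq0.
have tau1 : tau 1%g = 1%g by apply: (mulgI (tau 1%g)); rewrite -tauM !mulg1.
have tauV x : tau x^-1%g = (tau x)^-1%g.
  by apply: (mulgI (tau x)); rewrite -tauM !mulgV.
(* Writing [g = tau x], conjugation by [y^-1] and then by [tau y] sends [tau x] to
   [tau ((x ^ y^-1) ^ y) = tau x]. *)
apply/centerTP => g; apply/conjg_fixP/commgP/commute_sym/commgP/conjg_fixP.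
have [x <-] := tau_surj g; rewrite conjgM -tauJ.
by rewrite [LHS]conjgE -tauV -!tauM -conjgE conjgKV.
Qed.

(** The coefficient at [(y, h)] is [chi (tau y)] times the sum of [chi x * P x h]. Only central [x]
    contribute, where [chi] is 1, and [chi (tau y) = chi y] as [y^-1 * tau y] is central. *)
Lemma Lambda_c_fix_char chi : stem_group gT -> is_char chi ->
  c (glike chi 1%g) = glike chi 1%g.
Proof.
move=> stem cchi; have [tau [tauE tauZ]] := U_central_aut; have [c1 cM] := cchi.
apply: dcoef_ext => y h; rewrite dcoef_lin.
transitivity (\sum_x chi x * C x y h).
  apply: eq_bigr => x _; rewrite (sum_delta (i0 := 1%g)) => [|g ng]; rewrite dcoef_glike.
    by rewrite eqxx mulr1.
  by rewrite (negbTE ng) mulr0 mul0r.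
transitivity (\sum_x chi x * P (x * (tau y)^-1)%g h).
  apply: eq_bigr => x _; rewrite C_split (sum_delta (i0 := tau y)) ?tauE ?eqxx ?mul1r //.
  by move=> b nb; rewrite tauE (negbTE nb) mul0r.
rewrite (reindex_inj (mulIg (tau y))) dcoef_glike -(C_unit 1%g).
rewrite mulr_sumr; apply: eq_bigr => x _; rewrite mulgK cM mulrC mulrA -/(P x h).
have [->|/P_center/andP[zx _]] := eqVneq (P x h) 0; first by rewrite !(mulr0, mul0r).
rewrite (stem_char_center stem cchi zx) mulr1 mulrC; congr (_ * _).
by rewrite -{1}[tau y](mulKVg y) cM (stem_char_center stem cchi (tauZ y)) mulr1.
Qed.

End KeyLemma.

(** * Normality of Lambda_c over a stem group *)

Section Normality.
Variables (k : fieldType) (gT : finGroupType).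
Local Notation D := (Defs.double k gT).
Local Notation A := (hopfAut k gT).

Lemma glike_split (chi : gT -> k) (g : gT) :
  glike chi g = glike chi 1%g * glike (fun=> 1) g.
Proof.
rewrite glikeM ?mul1g; last exact: is_char1.
by apply: eq_glike => x; rewrite mulr1.
Qed.

Lemma stem_Lambda_c_fix_glike (c : A) (chi : gT -> k) g : stem_group gT ->
  Lambda_c k gT c -> is_char chi -> c (glike chi g) = glike chi g.
Proof.
move=> stem Lc cchi; have /Lambda_cP fix1 := Lc.
by rewrite glike_split autM fix1 Lambda_c_fix_char.
Qed.

Lemma stem_Lambda_c_normal : stem_group gT -> normal_subgroup (Lambda_c k gT).
Proof.
move=> stem; split=> [|x y Lx]; first exact: Lambda_c_subgroup.
apply/Lambda_cP => g; rewrite conjgE !mul_autE.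
have [chi [h [cchi E]]] := aut_glike y g (is_char1 k gT).
by rewrite E stem_Lambda_c_fix_glike // -E autVK.
Qed.

End Normality.

(** * Automorphisms prescribed on the basis *)

Section BasisExtension.
Variables (k : fieldType) (gT : finGroupType).
Local Notation D := (Defs.double k gT).
Local Notation A := (hopfAut k gT).
Implicit Types (x y g h b s t : gT) (X Y : D).
Variable F : gT -> gT -> D.

Definition basis_ext (X : D) : D := \sum_x \sum_g dcoef X x g *: F x g.

Fact basis_ext_is_linear : linear basis_ext.
Proof.
move=> a X Y; rewrite /basis_ext scaler_sumr -big_split; apply: eq_bigr => x _.
rewrite scaler_sumr -big_split; apply: eq_bigr => g _ /=.
by rewrite scalerA -scalerDl; congr (_ *: _); rewrite /dcoef !ffunE.
Qed.
HB.instance Definition _ :=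
  GRing.isLinear.Build k D D _ basis_ext basis_ext_is_linear.

Lemma basis_ext_dbasis g h : basis_ext (dbasis k (g, h)) = F g h.
Proof.
rewrite /basis_ext (sum_delta (i0 := g)) => [|x nx].
  rewrite (sum_delta (i0 := h)) => [|y ny]; rewrite dcoef_basis.
    by rewrite !eqxx scale1r.
  by rewrite (negbTE ny) andbF scale0r.
by rewrite big1 // => y _; rewrite dcoef_basis (negbTE nx) scale0r.
Qed.

End BasisExtension.

Section HopfAutFromBasis.
Variables (k : fieldType) (gT : finGroupType).
Local Notation D := (Defs.double k gT).
Local Notation A := (hopfAut k gT).
Implicit Types (x y g h b s t : gT) (X Y : D).
Variables F F' : gT -> gT -> D.
Hypothesis F_K : forall g h, basis_ext F' (F g h) = dbasis k (g, h).
Hypothesis F_1 : \sum_x F x 1%g = glike (fun=> 1) 1%g.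
Hypothesis F_M : forall g h g' h',
  F g h * F g' h' = (g == (h * g' * h^-1)%g)%:R *: F g (h * h')%g.
Hypothesis F_comul : forall g h,
  dcomul (F g h) = \sum_b tens (F b h) (F (g * b^-1)%g h).
Hypothesis F_counit : forall g h, dcounit (F g h) = (g == 1%g)%:R.

Lemma dcomul_sum (I : finType) (a : I -> k) (Y : I -> D) :
  dcomul (\sum_i a i *: Y i) = \sum_i a i *: dcomul (Y i).
Proof.
apply/dcoef2_ext => g h g' h'; rewrite dcoef2_comul dcoef_sum mulr_sumr dcoef2_sum.
by apply: eq_bigr => i _; rewrite dcoefZ dcoef2Z dcoef2_comul mulrCA.
Qed.

(** [F'] provides a left inverse, hence injectivity, and finite dimension gives bijectivity; the
    Hopf axioms extend linearly from the basis. *)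
Lemma hopf_aut_basis_ext : exists f : A, forall g h, f (dbasis k (g, h)) = F g h.
Proof.
pose f : 'End(D) := linfun (basis_ext F).
have fE g h : f (dbasis k (g, h)) = F g h by rewrite lfunE /= basis_ext_dbasis.
have f_inj : injective f.
  apply: (can_inj (g := basis_ext F')) => X.
  rewrite {1}(dbasis_sum X) !linear_sum [RHS](dbasis_sum X).
  by apply: eq_bigr => -[g h] _; rewrite !linearZ /= fE F_K.
have f_bij : bijective f.
  have kf : lker f == 0%VS by apply/lker0P.
  by exists (f^-1)%VF; [apply: lker0_lfunK | apply: lker0_lfunVK].
suff autf : is_hopf_aut f by exists (HopfAut (asboolT autf)).
split=> // [||X|X].
- have: f (glike (fun=> 1) 1%g) = glike (fun=> 1) 1%g; last by rewrite glike1.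
  by rewrite -{1}sum_dbasis1 linear_sum -F_1; apply: eq_bigr => x _; rewrite /= fE.
- move=> X Y; rewrite {1}(dbasis_sum X) {1}(dbasis_sum Y) mulr_suml linear_sum.
  rewrite [in RHS](dbasis_sum X) linear_sum mulr_suml; apply: eq_bigr => -[g h] _.
  rewrite mulr_sumr linear_sum [in RHS](dbasis_sum Y) linear_sum mulr_sumr.
  apply: eq_bigr => -[g' h'] _ /=.
  rewrite -!(scalerAl, scalerAr) !linearZ /= -!(scalerAl, scalerAr) dbasisM linearZ /=.
  rewrite !fE F_M [in LHS]scalerA [in RHS]scalerA [in RHS]mulrC.
  by congr (_ *: _); rewrite linearZ /= fE.
- rewrite (dbasis_sum X) linear_sum.
  under eq_bigr => a _ do rewrite linearZ.
  rewrite !dcomul_sum (linear_sum (@tensmap k gT f)); apply: eq_bigr => -[g h] _ /=.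
  rewrite fE (linearZ_LR (@tensmap k gT f)) /= tensmap_comul_basis F_comul.
  by congr (_ *: _); apply: eq_bigr => b _; rewrite !fE.
- rewrite !dcounitE; under eq_bigr => h _ do rewrite dcoef_lin.
  rewrite exchange_big (sum_delta (i0 := 1%g)) => [|x nx]; rewrite exchange_big /=.
    apply: eq_bigr => g _; rewrite -mulr_sumr; under eq_bigr => h _ do rewrite fE.
    by rewrite -dcounitE F_counit eqxx mulr1.
  rewrite big1 // => g _; rewrite -mulr_sumr; under eq_bigr => h _ do rewrite fE.
  by rewrite -dcounitE F_counit (negbTE nx) mulr0.
Qed.

End HopfAutFromBasis.

(** * The subgroup L and the factorization *)

Section Monomial.
Variables (k : fieldType) (gT : finGroupType).
Local Notation D := (Defs.double k gT).
Local Notation A := (hopfAut k gT).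
Implicit Types (x y g h b s t : gT) (X Y : D) (v : {perm gT}) (r : gT -> gT -> k).

(** The generator of L given by [r], followed by the one given by [v]. *)
Definition monomial_aut v r (f : A) :=
  forall g h, f (dbasis k (g, h)) = r h g *: dbasis k (v g, v h).

Lemma hom_dual_neq0 r h x : is_hom_dual r -> r h x != 0.
Proof.
move=> [r1 rM _]; apply/eqP => r0; have /eqP := r1 h.
by rewrite -(mulgV x) rM r0 mul0r eq_sym oner_eq0.
Qed.

Lemma hom_dual_is_char r h : is_hom_dual r -> is_char (r h).
Proof. by case. Qed.

Lemma hom_dual1 r x : is_hom_dual r -> r 1%g x = 1.
Proof.
move=> rh; have [_ _ rM] := rh; apply: (mulfI (hom_dual_neq0 1%g x rh)).
by rewrite -rM !mulg1 mulr1.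
Qed.

Lemma monomial_aut_exists v r : {morph v : x y / (x * y)%g} -> is_hom_dual r ->
  exists f, monomial_aut v r f.
Proof.
move=> vM rh; have [r1 rM rM'] := rh.
have v1 : v 1%g = 1%g by apply: (mulgI (v 1%g)); rewrite -vM !mulg1.
have vV x : v x^-1%g = (v x)^-1%g by apply: (mulgI (v x)); rewrite -vM !mulgV.
pose F g h : D := r h g *: dbasis k (v g, v h).
pose F' g h : D := (r ((v^-1)%g h) ((v^-1)%g g))^-1 *: dbasis k ((v^-1)%g g, (v^-1)%g h).
apply: (hopf_aut_basis_ext (F := F) (F' := F')) => [g h||g h g' h'|g h|g h]; rewrite /F.
- rewrite linearZ /= basis_ext_dbasis /F' !permK scalerA.
  by rewrite mulfV ?scale1r ?hom_dual_neq0.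
- rewrite -sum_dbasis1 [RHS](reindex_inj (@perm_inj _ v)).
  by apply: eq_bigr => x _; rewrite hom_dual1 // scale1r v1.
- rewrite -scalerAl -scalerAr dbasisM -vV -!vM (inj_eq perm_inj) !scalerA.
  have [->|_] := eqVneq g (h * g' * h^-1)%g; last by rewrite mulr0 mul0r !scale0r.
  rewrite mulr1 mul1r rM'; congr (_ * _ *: _).
  by have := is_charJ g' h^-1%g (hom_dual_is_char h' rh); rewrite conjgE invgK mulgA => ->.
- have := dcomul_sum (fun _ : 'I_1 => r h g) (fun _ => dbasis k (v g, v h)).
  rewrite !big_ord1 => ->; rewrite dcomul_basis scaler_sumr (reindex_inj (@perm_inj _ v)).
  apply: eq_bigr => b _; rewrite -vV -vM; apply: dcoef2_ext => y s y' s'.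
  rewrite dcoef2Z !dcoef2_tens !dcoefZ mulrACA -rM.
  by have := is_charJ g b^-1%g (hom_dual_is_char h rh); rewrite conjgE invgK => ->.
rewrite dcounitE; under eq_bigr => s _ do rewrite dcoefZ dcoef_basis.
rewrite (sum_delta (i0 := v h)) => [|s ns]; last by rewrite (negbTE ns) andbF mulr0.
rewrite eqxx andbT -{1}v1 (inj_eq perm_inj) eq_sym.
by have [->|_] := eqVneq g 1%g; rewrite ?r1 ?mulr0 ?mulr1.
Qed.

Definition monomial_auts : set A :=
  [set f | exists v r, [/\ {morph v : x y / (x * y)%g}, is_hom_dual r
                         & monomial_aut v r f]]%classic.

Lemma monomial_auts_subgroup : subgroup monomial_auts.
Proof.
split=> [|f f' [v [r [vM [r1 rM rM'] fE]]] [v' [r' [vM' [r'1 r'M r'M'] fE']]]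
        |f [v [r [vM rh fE]]]].
- exists 1%g, (fun _ _ => 1); split=> [x y||g h]; first by rewrite !perm1.
    by split=> *; rewrite ?mulr1.
  by rewrite one_autE !perm1 scale1r.
- have v1 : v' 1%g = 1%g by apply: (mulgI (v' 1%g)); rewrite -vM' !mulg1.
  (* Permutations compose from left to right, so [v' * v] applies [v'] first, as [f * f'] does with
     [f']. *)
  exists (v' * v)%g, (fun h g => r' h g * r (v' h) (v' g)); split=> [x y||g h].
  + by rewrite !permM vM' vM.
  + split=> [h|h x y|h h' x]; first by rewrite r'1 v1 r1 mulr1.
      by rewrite r'M vM' rM mulrACA.
    by rewrite r'M' vM' rM' mulrACA.
  + by rewrite mul_autE fE' linearZ /= fE scalerA !permM.
have [r1 rM rM'] := rh.
have vVM : {morph (v^-1)%g : x y / (x * y)%g}.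
  by move=> x y; apply: (@perm_inj _ v); rewrite vM !permKV.
have vV1 : (v^-1)%g 1%g = 1%g by apply: (mulgI ((v^-1)%g 1%g)); rewrite -vVM !mulg1.
exists (v^-1)%g, (fun h g => (r ((v^-1)%g h) ((v^-1)%g g))^-1); split=> [//||g h].
  split=> [h|h x y|h h' x]; first by rewrite vV1 r1 invr1.
    by rewrite vVM rM invfM.
  by rewrite vVM rM' invfM.
apply: (@aut_inj _ _ f); rewrite autKV linearZ /= fE !permKV scalerA.
by rewrite mulVf ?scale1r ?hom_dual_neq0.
Qed.

Lemma L_subgroup_subgroup : subgroup (L_subgroup k gT).
Proof.
split=> [M [[]] //|f f' Lf Lf' M MM|f Lf M MM]; have [[_ MM2 MV] _] := MM.
  by apply: MM2; [apply: Lf | apply: Lf'].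
by apply: MV; apply: Lf.
Qed.

Lemma AutT_morph (v : {perm gT}) :
  v \in Aut [set: gT]%SET <-> {morph v : x y / (x * y)%g}.
Proof.
rewrite inE; split=> [/andP[_ /morphicP vM] x y|vM]; first by rewrite vM ?inE.
apply/andP; split; first by apply/fintype.subsetP => x _; rewrite inE.
by apply/morphicP => x y _ _; apply: vM.
Qed.

(** The monomial automorphisms form a subgroup containing all generators, and each is a generator of
    the first kind times one of the second. *)
Lemma L_subgroupE : L_subgroup k gT = monomial_auts.
Proof.
apply/seteqP; split=> [f Lf|f [v [r [vM rh fE]]]].
  apply: Lf; split; first exact: monomial_auts_subgroup.
  move=> {}f [[v /AutT_morph vM fE]|[r rh fE]].
    exists v, (fun _ _ => 1); split=> [//||g h]; last by rewrite scale1r.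
    by split=> *; rewrite ?mulr1.
  exists 1%g, r; split=> [x y|//|g h]; first by rewrite !perm1.
  by rewrite fE !perm1.
have trivial_dual : is_hom_dual (fun _ _ : gT => 1 : k) by split=> *; rewrite ?mulr1.
have [a aE] := monomial_aut_exists vM trivial_dual.
have M1 : {morph (1%g : {perm gT}) : x y / (x * y)%g} by move=> x y; rewrite !perm1.
have [b bE] := monomial_aut_exists M1 rh.
have -> : f = (a * b)%g.
  apply: aut_basis_eq => g h.
  by rewrite fE mul_autE bE linearZ /= aE !perm1 scale1r.
move=> M [[_ MM _] gensM]; apply: MM; apply: gensM; [left|right].
  by exists v => [|g h]; [apply/AutT_morph | rewrite aE scale1r].
by exists r => // g h; rewrite bE !perm1.
Qed.

Lemma monomial_aut_glike v r f g : {morph v : x y / (x * y)%g} ->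
  monomial_aut v r f ->
  f (glike (fun=> 1) g) = glike (fun x => r g ((v^-1)%g x)) (v g).
Proof.
move=> vM fE; have -> : glike (fun=> 1) g = \sum_x dbasis k (x, g).
  apply: dcoef_ext => y h; rewrite dcoef_glike mul1r dcoef_sum.
  rewrite (sum_delta (i0 := y)) => [|x nx]; rewrite dcoef_basis ?eqxx //.
  by rewrite eq_sym (negbTE nx).
apply: dcoef_ext => y h; rewrite linear_sum dcoef_sum dcoef_glike.
rewrite (sum_delta (i0 := (v^-1)%g y)) => [|x nx]; rewrite /= fE dcoefZ dcoef_basis.
  by rewrite permKV eqxx.
rewrite [y == _](_ : _ = false) ?mulr0 //; apply: contraNF nx => /eqP ->.
by rewrite permK.
Qed.

(** A monomial automorphism sends [1 # g] to a group-like over [v g] whose character is [r g]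
    transported by [v]; fixing [1 # g] makes both trivial. *)
Lemma Lambda_cI_L : (Lambda_c k gT `&` L_subgroup k gT = [set 1%g])%classic.
Proof.
rewrite L_subgroupE; apply/seteqP; split=> [f [/Lambda_cP fix1]|_ ->]; last first.
  by split; [have [] := Lambda_c_subgroup k gT | have [] := monomial_auts_subgroup].
move=> [v [r [vM rh fE]]]; apply: aut_basis_eq => g h; rewrite fE one_autE.
have rc x : is_char (fun y => r x ((v^-1)%g y)).
  have [r1 rM _] := rh; have vVM y z : ((v^-1) (y * z) = (v^-1) y * (v^-1) z)%g.
    by apply: (@perm_inj _ v); rewrite vM !permKV.
  split=> [|y z]; last by rewrite vVM rM.
  by rewrite (_ : (v^-1)%g 1%g = 1%g) ?r1 //; apply: (mulgI ((v^-1)%g 1%g)); rewrite -vVM !mulg1.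
have fixE x : (forall y, r x ((v^-1)%g y) = 1) /\ v x = x.
  by apply: glike_inj; [apply: rc | apply: is_char1 | rewrite -(monomial_aut_glike x vM fE) fix1].
have [rE _] := fixE h; have := rE (v g); rewrite permK => ->.
by rewrite scale1r (fixE g).2 (fixE h).2.
Qed.

End Monomial.

(** * Factoring automorphisms over a stem group *)

Section Factorization.
Variables (k : fieldType) (gT : finGroupType).
Local Notation A := (hopfAut k gT).
Implicit Types (x y g h z : gT).

(* Central factors drop out of commutators, so the image of v contains the
   derived subgroup, hence the center. *)
Lemma stem_bij_of_central_cover (v : gT -> gT) : stem_group gT ->
  {morph v : x y / (x * y)%g} ->
  (forall h, exists z g, z \in 'Z([set: gT])%g /\ h = (z * v g)%g) -> bijective v.
Proof.
move=> /fintype.subsetP stem vM cover.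
have v1 : v 1%g = 1%g by apply: (mulgI (v 1%g)); rewrite -vM !mulg1.
have vV x : v x^-1%g = (v x)^-1%g by apply: (mulgI (v x)); rewrite -vM !mulgV.
have gK : group_set (v @: [set: gT]%SET).
  apply/group_setP; split=> [|_ _ /imsetP[x _ ->] /imsetP[y _ ->]].
    by apply/imsetP; exists 1%g; rewrite ?inE ?v1.
  by apply/imsetP; exists (x * y)%g; rewrite ?inE ?vM.
have dK : [set: gT]^`(1)%g \subset Group gK.
  rewrite derg1 gen_subG; apply/fintype.subsetP => _ /imset2P[y y' _ _ ->].
  have [z [g [zZ ->]]] := cover y; have [z' [g' [zZ' ->]]] := cover y'.
  have -> : [~ z * v g, z' * v g']%g = v [~ g, g']%g.
    move/centerTP in zZ; rewrite !commgEl conjMg zZ conjgM (center_conj _ zZ').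
    by rewrite invMg -mulgA mulKg !conjgE !(vM, vV).
  by apply/imsetP; exists [~ g, g']%g; rewrite ?inE.
have v_surj h : exists g, v g = h.
  have [z [g [/stem/(fintype.subsetP dK)/imsetP[y _ ->] ->]]] := cover h.
  by exists (y * g)%g; rewrite vM.
have [w wK] := choice v_surj.
exact: (bij_can_bij (injF_bij (can_inj wK)) wK).
Qed.

(** Writing f(1 # g) as [rho g # v g] gives homomorphisms [rho] and [v]; once [v] is known to be
    bijective, they define the element of L. *)
Lemma stem_factor (f : A) : stem_group gT ->
  exists2 l, L_subgroup k gT l & forall g, f (glike (fun=> 1) g) = l (glike (fun=> 1) g).
Proof.
move=> stem.
have /choice[w wE] : forall g, exists p : (gT -> k) * gT,
    is_char p.1 /\ f (glike (fun=> 1) g) = glike p.1 p.2.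
  move=> g; have [chi [h [cchi E]]] := aut_glike f g (is_char1 k gT).
  by exists (chi, h).
pose rho g := (w g).1; pose v g := (w g).2.
have rc g : is_char (rho g) := (wE g).1.
have fE g : f (glike (fun=> 1) g) = glike (rho g) (v g) := (wE g).2.
have charM (chi chi' : gT -> k) : is_char chi -> is_char chi' ->
    is_char (fun x => chi x * chi' x).
  move=> [c1 cM] [c'1 c'M]; split=> [|x y]; first by rewrite c1 c'1 mulr1.
  by rewrite cM c'M mulrACA.
have wM g h : rho (g * h)%g =1 (fun x => rho g x * rho h x) /\ v (g * h)%g = (v g * v h)%g.
  apply: glike_inj; [exact: rc | exact: charM | rewrite -glikeM // -!fE -autM].
  by rewrite glikeM; [congr (f _); apply: eq_glike => x; rewrite mulr1 | apply: is_char1].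
have vM : {morph v : x y / (x * y)%g} by move=> x y; have [] := wM x y.
(* The element [chi # 1] commutes with all group-likes, and every [1 # h] is the image of one; so
   [z] commutes with every [h]. *)
have f_glike chi : is_char chi -> exists chi' z,
    [/\ is_char chi', f (glike chi 1%g) = glike chi' z & z \in 'Z([set: gT])%g].
  move=> cchi; have [chi' [z [cchi' E]]] := aut_glike f 1%g cchi.
  exists chi', z; split=> //; apply/centerP; split=> [|h _]; rewrite ?inE //.
  have [xi [g [cxi E']]] := aut_glike (f^-1)%g h (is_char1 k gT).
  have Eh : f (glike xi g) = glike (fun=> 1) h by rewrite -E' autKV.
  have EM : glike chi' z * glike (fun=> 1) h = glike (fun=> 1) h * glike chi' z.
    rewrite -E -Eh -!autM !glikeM // mul1g mulg1; congr (f _).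
    by apply: eq_glike => x; rewrite mulrC.
  rewrite !glikeM // in EM; last exact: is_char1.
  by case: (glike_inj _ _ EM) => //; apply: charM => //; apply: is_char1.
(* Split the preimage of [1 # h] as [(xi # 1) (1 # g)] and apply [f]. *)
have cover h : exists z g, z \in 'Z([set: gT])%g /\ h = (z * v g)%g.
  have [xi [g [cxi E']]] := aut_glike (f^-1)%g h (is_char1 k gT).
  have [chi' [z [cchi' E zZ]]] := f_glike xi cxi; exists z, g; split=> //.
  have Eh : glike (fun=> 1) h = glike chi' z * glike (rho g) (v g).
    by rewrite -E -fE -autM -glike_split -E' autKV.
  rewrite glikeM // in Eh.
  by case: (glike_inj _ _ Eh) => //; [apply: is_char1 | apply: charM].
have v_bij := stem_bij_of_central_cover stem vM cover.
pose p := perm (bij_inj v_bij).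
have pM : {morph p : x y / (x * y)%g} by move=> x y; rewrite !permE vM.
have v1 : v 1%g = 1%g by apply: (mulgI (v 1%g)); rewrite -vM !mulg1.
(* Composing with [v] compensates for the [v^-1] in [monomial_aut_glike]. *)
have rh : is_hom_dual (fun g x => rho g (v x)).
  split=> [h|h x y|h h' x]; first by rewrite v1; have [] := rc h.
    by rewrite vM; have [_ ->] := rc h.
  by have [-> _] := wM h h'.
have [l lE] := monomial_aut_exists pM rh.
exists l; first by rewrite L_subgroupE; exists p, (fun g x => rho g (v x)).
move=> g; rewrite (monomial_aut_glike g pM lE) fE permE; apply: eq_glike => x.
by rewrite -(permE (bij_inj v_bij)) -/p permKV.
Qed.

Lemma stem_internal_sdprod : stem_group gT ->
  internal_sdprod (Lambda_c k gT) (L_subgroup k gT).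
Proof.
move=> stem; have normal := stem_Lambda_c_normal k stem.
split=> //; [exact: L_subgroup_subgroup | exact: Lambda_cI_L |].
apply/seteqP; split=> // f _; have [l Ll fl] := stem_factor f stem.
have [_ _ LV] := L_subgroup_subgroup k gT; have [_ NJ] := normal.
have Nc : Lambda_c k gT (l^-1 * f)%g.
  by apply/Lambda_cP => g; rewrite mul_autE fl autVK.
(* The factor in Lambda_c must stand on the left: normality moves [l^-1 * f] to its conjugate
   [f * l^-1]. *)
exists (f * l^-1)%g; last by exists l => //; rewrite mulgKV.
by have := NJ _ l^-1%g Nc; rewrite conjgE invgK !mulgA mulgV mul1g.
Qed.

End Factorization.

(** * Groups that are not stem *)

(** Translation by [t] multiplies the sum by [chi t]. *)
Lemma char_sum0 (k : fieldType) (rT : finGroupType) (H : {group rT})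
    (chi : rT -> k) t :
  {in H &, forall x y, chi (x * y)%g = chi x * chi y} ->
  t \in H -> chi t != 1 -> \sum_(x in H) chi x = 0.
Proof.
move=> cM tH nt; apply/eqP; have: (chi t - 1) * \sum_(x in H) chi x == 0.
  rewrite mulrBl mul1r subr_eq0 [eqbRHS](reindex_inj (mulgI t)) mulr_sumr.
  apply/eqP/eq_big => x; first by rewrite groupMl.
  by move=> xH; rewrite cM.
by rewrite mulf_eq0 subr_eq0 (negbTE nt).
Qed.

(** * Roots of unity and pairings on cyclic groups *)

Section Pairing.
Variable k : closedFieldType.
Hypothesis char0 : [pchar k] =i pred0.

Lemma prim_root_exists n : (0 < n)%N -> exists w : k, n.-primitive_root w.
Proof.
move=> n_gt0; have [rs Ers] := closed_field_poly_normal ('X^n - 1 : {poly k}).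
have sz : size ('X^n - 1 : {poly k}) = n.+1 by rewrite size_XnsubC.
rewrite lead_coefXnsubC // scale1r in Ers.
have n_neq0 : n%:R != 0 :> k by rewrite (pcharf0P k).1 -?lt0n.
suff /hasP[w _ pw] : has n.-primitive_root rs by exists w.
apply: has_prim_root => //.
- apply/allP => w w_rs; apply/unity_rootP; apply/eqP.
  have : root ('X^n - 1) w by rewrite Ers root_prod_XsubC.
  by rewrite /root !hornerE ?hornerXn subr_eq0.
- by rewrite -separable_prod_XsubC -Ers separable_Xn_sub_1.
by have := sz; rewrite Ers size_prod_XsubC => -[->].
Qed.

(** On a cyclic group with generator [y], the pairing of [y ^+ i] and [y ^+ j] is [w ^+ (i * j)] for
    a primitive root of unity [w] of order that of [y]; pairing with [y] itself shows
    nondegeneracy. *)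
Lemma cyclic_pairing (rT : finGroupType) (H : {group rT}) : cyclic H ->
  exists b : rT -> rT -> k,
  [/\ {in H & &, forall s s' t, b (s * s')%g t = b s t * b s' t},
      forall s t, b s t = b t s, forall s t, b s t != 0
    & {in H, forall s, s != 1%g -> exists2 t, t \in H & b s t != 1}].
Proof.
case/cyclicP=> y ->; have [w pw] := prim_root_exists (order_gt0 y).
(* [l] is a discrete logarithm to base [y], with an arbitrary value outside the cyclic group. *)
have /choice[l lE] : forall x, exists i, x \in <[y]>%g -> x = (y ^+ i)%g.
  move=> x; case xy: (x \in <[y]>%g); last by exists 0%N.
  by have [i _ ->] := cyclePmin xy; exists i.
exists (fun s t => w ^+ (l s * l t)); split=> [s s' t sy sy' ty|s t|s t|s sy ns].
- apply/eqP; rewrite -exprD -mulnDl (eq_prim_root_expr pw) -modnMml -[eqbRHS]modnMml.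
  suff /eqP-> : l (s * s')%g == (l s + l s')%N %[mod #[y]%g] by [].
  by rewrite -eq_expg_mod_order -lE ?groupM // expgD -!lE.
- by rewrite mulnC.
- by rewrite expf_eq0 (prim_root_eq0 pw) eqn0Ngt order_gt0 andbF.
exists y; first exact: cycle_id.
apply: contra ns => /eqP/esym/eqP; rewrite -(expr0 w) (eq_prim_root_expr pw).
rewrite -modnMmr; have /eqP-> : l y == 1%N %[mod #[y]%g].
  by rewrite -eq_expg_mod_order -lE ?cycle_id.
by rewrite modnMmr muln1 -eq_expg_mod_order -lE // expg0 eq_sym.
Qed.

End Pairing.

(** * Automorphisms built from a central kernel *)

Section KernelAut.
Variables (k : fieldType) (gT : finGroupType).
Local Notation D := (Defs.double k gT).
Local Notation A := (hopfAut k gT).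
Implicit Types (x y g h s t u : gT).
(* K is the matrix of p, and the kernel automorphism has u = id. *)
Variable K : gT -> gT -> k.
Hypothesis K_sym : forall s t, K s t = K t s.
Hypothesis K_comm : forall x y t, K (x * y)%g t = K (y * x)%g t.
Hypothesis K_center : forall s t, K s t != 0 -> t \in 'Z([set: gT])%g.
Hypothesis K_orth : forall s t t',
  \sum_x K x t * K (s * x^-1)%g t' = (t == t')%:R * K s t.
Hypothesis K_sum : forall t, \sum_s K s t = (t == 1%g)%:R.

(** The image of e_g # h is the sum over y of e_y # p(e_(y^-1 g)) h; for the inverse, p is composed
    with the antipode, which inverts the first argument of [K]. *)
Let F g h : D := [ffun c => K (c.1^-1 * g)%g (c.2 * h^-1)%g].
Let F' g h : D := [ffun c => K (c.1^-1 * g)^-1%g (c.2 * h^-1)%g].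

Let dcoef_F g h y u : dcoef (F g h) y u = K (y^-1 * g)%g (u * h^-1)%g.
Proof. by rewrite /dcoef ffunE. Qed.

(** [K_orth] says that p is comultiplicative; by symmetry of [K] it also says that p is
    multiplicative. *)
Let K_orth' s s' t : \sum_x K s x * K s' (t * x^-1)%g = (s == s')%:R * K s t.
Proof.
by rewrite [K s t]K_sym -K_orth; apply: eq_bigr => x _; rewrite ![K _ x]K_sym [K s' _]K_sym.
Qed.

Let K_suml y t : \sum_x K (y^-1 * x)%g t = (t == 1%g)%:R.
Proof.
rewrite -K_sum (reindex_inj (mulgI y)); apply: eq_bigr => x _.
by rewrite mulKg.
Qed.

Lemma kernel_aut_exists : exists f : A, forall g h y u,
  dcoef (f (dbasis k (g, h))) y u = K (y^-1 * g)%g (u * h^-1)%g.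
Proof.
suff [f fE] : exists f : A, forall g h, f (dbasis k (g, h)) = F g h.
  by exists f => g h y u; rewrite fE dcoef_F.
apply: (hopf_aut_basis_ext (F' := F')) => [g h||g h g' h'|g h|g h].
- apply: dcoef_ext => y w; rewrite /basis_ext dcoef_sum dcoef_basis.
  (* Summing over the kG-coordinate first, [K_orth'] forces [y = g]; the remaining sum over [x] is
     [K_sum]. *)
  transitivity (\sum_x (y == g)%:R * K (x^-1 * g)%g (w * h^-1)%g).
    apply: eq_bigr => x _; rewrite dcoef_sum (reindex_inj (mulIg h)) /=.
    rewrite -(inj_eq (mulgI x^-1%g)) eq_sym -K_orth'; apply: eq_bigr => t _.
    rewrite dcoefZ dcoef_F mulgK /dcoef ffunE /= !invMg !invgK.
    by rewrite !mulgA.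
  rewrite -mulr_sumr (reindex_inj (h := fun x => g * x^-1)%g) => [|x x' /mulgI/invg_inj //].
  under eq_bigr => x _ do rewrite invMg invgK mulgKV.
  by rewrite K_sum -eq_mulgV1 -natrM mulnb.
- apply: dcoef_ext => y u; rewrite dcoef_sum dcoef_glike mul1r.
  by under eq_bigr => x _ do rewrite dcoef_F invg1 mulg1; rewrite K_suml.
- apply: dcoef_ext => y u; rewrite dcoefM dcoefZ dcoef_F.
  rewrite -(inj_eq (mulgI y^-1%g)) -K_orth' (reindex_inj (mulIg h)).
  apply: eq_bigr => t _ /=; rewrite !dcoef_F mulgK.
  (* Only central [t] contribute, so the conjugation of [y] in the product disappears. *)
  have [->|/K_center tZ] := eqVneq (K (y^-1 * g)%g t) 0; first by rewrite !mul0r.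
  rewrite conjgM (center_conj _ tZ); congr (_ * _).
  rewrite conjgE !invMg invgK -!mulgA K_comm K_sym.
  by rewrite [(h^-1 * _)%g]mulgA K_comm K_sym -!mulgA.
- apply: dcoef2_ext => y u y' u'; rewrite dcoef2_comul dcoef_F dcoef2_sum.
  rewrite -(inj_eq (mulIg h^-1%g)) -K_orth [RHS](reindex_inj (mulgI y)).
  apply: eq_bigr => s _; rewrite dcoef2_tens !dcoef_F mulKg; congr (_ * _).
  by rewrite !invMg !mulgA [RHS]K_comm !mulgA.
rewrite dcounitE; under eq_bigr => u _ do rewrite dcoef_F invg1 mul1g K_sym.
by rewrite (reindex_inj (mulIg h)); under eq_bigr => u _ do rewrite mulgK; rewrite K_sum.
Qed.

End KernelAut.

(** * Normality of Lambda_c forces the group to be stem *)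

Section Converse.
Variables (k : closedFieldType) (gT : finGroupType).
Hypothesis char0 : [pchar k] =i pred0.
Local Notation A := (hopfAut k gT).

(** The kernel is the pairing on H divided by the order of H. As [b s 1 = 1], the coefficient in
    question is the average of [chi] over H, which vanishes when [chi] is nontrivial on H. *)
Lemma center_kernel_aut (H : {group gT}) : cyclic H -> H \subset 'Z([set: gT]%SET)%g ->
  exists2 c : A, Lambda_c k gT c &
    forall chi g, dcoef (c (glike chi g)) 1%g g = (#|H|%:R)^-1 * \sum_(x in H) chi x.
Proof.
move=> cycH /fintype.subsetP HZ; have [b [bM b_sym b_neq0 b_nondeg]] := cyclic_pairing char0 cycH.
have H_neq0 : #|H|%:R != 0 :> k by rewrite (pcharf0P k).1 // -lt0n cardG_gt0.
have b1 t : t \in H -> b 1%g t = 1.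
  by move=> tH; apply: (mulfI (b_neq0 1%g t)); rewrite -bM ?group1 // mulg1 mulr1.
have bV s t : s \in H -> t \in H -> b s^-1%g t = (b s t)^-1.
  move=> sH tH; apply: (mulfI (b_neq0 s t)).
  by rewrite -bM ?groupV // mulgV b1 // mulfV.
have b_sum t : t \in H -> \sum_(s in H) b s t = (t == 1%g)%:R * #|H|%:R.
  move=> tH; have [->|nt] := eqVneq t 1%g.
    rewrite mul1r -sum1_card natr_sum; apply: eq_bigr => s sH.
    by rewrite b_sym b1.
  have [s sH ns] := b_nondeg t tH nt; rewrite mul0r.
  apply: (char_sum0 _ sH); last by rewrite b_sym.
  by move=> x y xH yH; rewrite bM.
(* For s in H, the sum of the K s t t is a primitive idempotent of k[H]. *)
pose K s t := if (s \in H) && (t \in H) then b s t / #|H|%:R else 0.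
have K_sym s t : K s t = K t s by rewrite /K andbC b_sym.
have K_center s t : K s t != 0 -> t \in 'Z([set: gT])%g.
  by rewrite /K; case: ifP => [/andP[_ /HZ]|]; rewrite ?eqxx.
have K_comm x y t : K (x * y)%g t = K (y * x)%g t.
  (* A product lying in H is central, so its two factors commute. *)
  have commH (u v : gT) : (u * v)%g \in H -> (u * v)%g = (v * u)%g.
    by move=> /HZ/centerTP/(_ u)/esym->; rewrite conjgE -mulgA mulKg.
  rewrite /K; have [xyH|xyH] := boolP ((x * y)%g \in H); first by rewrite -(commH _ _ xyH) xyH.
  by have [/[dup] yxH /commH E|//] := boolP ((y * x)%g \in H); rewrite -E yxH in xyH.
have K_sum t : \sum_s K s t = (t == 1%g)%:R.
  have [tH|tH] := boolP (t \in H); last first.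
    rewrite big1 => [|s _]; last by rewrite /K (negbTE tH) andbF.
    by case: eqP tH => // ->; rewrite group1.
  rewrite -(mulfK H_neq0 (t == 1%g)%:R) -b_sum // mulr_suml [RHS]big_mkcond.
  by apply: eq_bigr => s _; rewrite /K tH andbT.
have K_orth s t t' : \sum_x K x t * K (s * x^-1)%g t' = (t == t')%:R * K s t.
  have [tH|tH] := boolP (t \in H); last first.
    by rewrite /K (negbTE tH) andbF mulr0 big1 // => x _; rewrite andbF mul0r.
  have [tH'|tH'] := boolP (t' \in H); last first.
    rewrite big1 => [|x _]; last by rewrite {2}/K (negbTE tH') andbF mulr0.
    by case: eqP tH' => [<-|_ _]; rewrite ?tH ?mul0r.
  have [sH|sH] := boolP (s \in H); last first.
    rewrite {3}/K (negbTE sH) mulr0 big1 // => x _; rewrite /K.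
    case: (boolP (x \in H)) => xH; last by rewrite mul0r.
    by rewrite groupMr ?groupV // (negbTE sH) mulr0.
  have Et : (t == t') = ((t * t'^-1)%g == 1%g) by rewrite eq_mulgV1.
  (* Bimultiplicativity separates the factor depending on [x]; [b_sum] evaluates what is left. *)
  transitivity (b s t' / #|H|%:R / #|H|%:R * \sum_(x in H) b x (t * t'^-1)%g).
    rewrite mulr_sumr [RHS]big_mkcond; apply: eq_bigr => x _ /=; rewrite /K tH tH' !andbT.
    case: (boolP (x \in H)) => xH; last by rewrite mul0r.
    rewrite groupMl ?groupV // xH bM ?groupV // bV // [b x (_ * _)%g]b_sym bM ?groupV //.
    by rewrite bV // ![b _ x]b_sym; ring.
  rewrite b_sum ?groupM ?groupV // -Et /K sH tH /=.
  have [->|_] := eqVneq t t'; last by rewrite !mul0r mulr0.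
  by rewrite !mul1r mulfVK.
have [c cE] := kernel_aut_exists K_sym K_comm K_center K_orth K_sum.
have c_glike chi g y u : dcoef (c (glike chi g)) y u
    = \sum_x chi x * K (y^-1 * x)%g (u * g^-1)%g.
  rewrite dcoef_lin; apply: eq_bigr => x _.
  rewrite (sum_delta (i0 := g)) => [|h nh]; rewrite dcoef_glike ?eqxx ?mulr1 ?cE //.
  by rewrite (negbTE nh) mulr0 mul0r.
exists c.
  apply/Lambda_cP => g; apply: dcoef_ext => y u; rewrite c_glike dcoef_glike.
  under eq_bigr => x _ do rewrite mul1r.
  rewrite (reindex_inj (mulgI y)); under eq_bigr => x _ do rewrite mulKg.
  by rewrite K_sum -eq_mulgV1 mul1r.
move=> chi g; rewrite c_glike mulr_sumr [RHS]big_mkcond; apply: eq_bigr => x _.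
rewrite invg1 mul1g mulgV /K group1 andbT; case: ifP => xH; last by rewrite mulr0.
by rewrite b_sym b1 // div1r mulrC.
Qed.

(** The irreducible characters here are complex-valued, so one of them only provides a normal
    subgroup [N] avoiding [z] with cyclic quotient; the values in [k] come from the pairing on that
    quotient. *)
Lemma hom_dual_separates z : z \notin [set: gT]%SET^`(1)%g ->
  exists2 r : gT -> gT -> k, is_hom_dual r & exists g, r g z != 1.
Proof.
rewrite -cap_cfker_lin_irr => nz.
have [i lin_i nzi] : exists2 i : Iirr [set: gT]%G,
    'chi_i \is a linear_char & z \notin cfker 'chi_i.
  apply/exists_inP; apply: contraR nz; rewrite negb_exists_in => /forall_inP zker.
  by apply/bigcapP => i /zker; rewrite negbK.
set N := cfker _ in nzi.
have nN x : x \in 'N(N)%g by have /normal_norm/fintype.subsetP := cfker_normal 'chi_i; apply; rewrite inE.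
(* The quotient by the kernel of an irreducible character has cyclic center, and here it is
   abelian. *)
have cycQ : cyclic ([set: gT] / N)%g.
  have abQ : abelian ([set: gT] / N)%g by apply/sub_der1_abelian/lin_char_der1.
  by have := cfcenter_cyclic 'chi_i; rewrite cfcenter_eq_center (center_idP abQ).
have [b [bM b_sym b_neq0 b_nondeg]] := cyclic_pairing char0 cycQ.
have QT x : coset N x \in ([set: gT] / N)%g by rewrite mem_quotient ?inE.
have cosetNM x y : coset N (x * y)%g = (coset N x * coset N y)%g by rewrite morphM.
have b1 x : b (coset N x) 1%g = 1.
  rewrite b_sym; apply: (mulfI (b_neq0 1%g (coset N x))).
  by rewrite -bM ?group1 // mulg1 mulr1.
exists (fun g x => b (coset N g) (coset N x)).
  split=> [g|g x y|g h x].
  - by rewrite morph1.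
  - by rewrite cosetNM b_sym bM // ![b _ (coset N g)]b_sym.
  - by rewrite cosetNM bM.
have [|t /morphimP[g _ _ ->] ng] := b_nondeg _ (QT z).
  by apply: contra nzi => /eqP; apply: coset_idr.
by exists g; rewrite b_sym.
Qed.

Lemma Lambda_c_normal_stem : normal_subgroup (Lambda_c k gT) -> stem_group gT.
Proof.
move=> [_ NJ]; apply/fintype.subsetP => z zZ; apply: contraT => nz.
have [r rh [g rgz]] := hom_dual_separates nz.
have [||c Lc cE] := center_kernel_aut (H := <[z]>%G); first exact: cycle_cyclic.
  by rewrite cycle_subG.
have M1 : {morph (1%g : {perm gT}) : x y / (x * y)%g} by move=> x y; rewrite !perm1.
have [rho rhoE] := monomial_aut_exists M1 rh.
have /Lambda_cP/(_ g) fixJ := NJ c rho Lc.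
rewrite conjgE !mul_autE in fixJ.
(* Thus [c] fixes the image of [1 # g] under [rho], which is [r g # g]. Its coefficient at [(1, g)]
   is 1, but the average of [r g] over the group generated by [z] is 0. *)
have := congr1 (fun X => dcoef X 1%g g) (congr1 rho fixJ).
rewrite /= autKV (monomial_aut_glike g M1 rhoE) perm1 cE.
rewrite (char_sum0 (t := z)) ?cycle_id //; first last.
- by rewrite invg1 perm1.
- by have [_ rM _] := rh; move=> x y _ _; rewrite invg1 !perm1 rM.
have [r1 _ _] := rh.
by rewrite mulr0 dcoef_glike eqxx invg1 perm1 r1 mulr1 => /eqP; rewrite eq_sym oner_eq0.
Qed.

End Converse.

Theorem theorem7p3 (k : closedFieldType) (char0 : [pchar k]%R =i pred0)
    (gT : finGroupType) :
  (normal_subgroup (Lambda_c k gT) <-> stem_group gT) /\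
  (internal_sdprod (Lambda_c k gT) (L_subgroup k gT) <-> stem_group gT).
Proof.
split; split=> [|stem].
- exact: Lambda_c_normal_stem.
- exact: stem_Lambda_c_normal.
- by case=> normal _ _ _; apply: (Lambda_c_normal_stem char0 normal).
- exact: stem_internal_sdprod.
Qed.
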